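(* Let $p\ge 5$ be a prime with $p\equiv 2 \pmod 3$, let $q\in\mathbb{N}$ and $\theta\in\mathbb{Q}_p$ satisfy $|\theta-1|_p<|q|_p<1$ and $(\theta-1)(1-\theta-q)\neq 0$. Let $f_{\theta,q,3}$ be the Potts--Bethe mapping, $\mathbf{x}^{(\infty)}=2-\theta-q$ its singular point, $\mathbf{x}^{(0)}=1$, and $\mathbf{x}^{(1)}=1-q+(\theta-1)(\mathbf{y}^{(1)}-1)$. Then the basin of attraction of $\mathbf{x}^{(0)}$ is $$\mathfrak{B}\left(\mathbf{x}^{(0)}\right)=\mathbb{Q}_p\setminus\left(\{\mathbf{x}^{(1)}\}\cup\bigcup_{n=0}^{+\infty} f_{\theta,q,3}^{(-n)}\{\mathbf{x}^{(\infty)}\}\right).$$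
   Context: $\mathbb{Q}_p$ is the field of $p$-adic numbers with its usual norm $|\cdot|_p$ ($|p|_p=p^{-1}$). The Potts--Bethe mapping is $$f_{\theta,q,3}(x)=\left(\frac{\theta x+q-1}{x+\theta+q-2}\right)^3,$$ defined for $x\in\mathbf{Dom}\{f_{\theta,q,3}\}:=\mathbb{Q}_p\setminus\{\mathbf{x}^{(\infty)}\}$, where $\mathbf{x}^{(\infty)}:=2-\theta-q$. Iterates are $f^{(n+1)}_{\theta,q,3}(x)=f_{\theta,q,3}(f^{(n)}_{\theta,q,3}(x))$ (whenever defined), with $f^{(0)}$ the identity. For a set $S\subset\mathbb{Q}_p$, $f^{(-n)}_{\theta,q,3}(S)$ is the set of all $x\in\mathbb{Q}_p$ for which $f^{(n)}_{\theta,q,3}(x)$ is defined and lies in $S$; in particular $f^{(-0)}_{\theta,q,3}\{\mathbf{x}^{(\infty)}\}=\{\mathbf{x}^{(\infty)}\}$, and $\bigcup_{n\ge 0} f^{(-n)}_{\theta,q,3}\{\mathbf{x}^{(\infty)}\}$ is the set of eventually singular points. Under the hypotheses, the cubic equation $$y^3-(1+\theta+\theta^2)y^2-(2\theta+1)(1-\theta-q)y-(1-\theta-q)^2=0$$ has a unique root in $\mathbb{Q}_p$, denoted $\mathbf{y}^{(1)}$. The basin of attraction is $$\mathfrak{B}(\mathbf{x}^{(0)}):=\left\{x\in\mathbb{Q}_p:\ \lim_{n\to+\infty}f^{(n)}_{\theta,q,3}(x)=\mathbf{x}^{(0)}\right\},$$ consisting of points all of whose iterates are defined and converge to $\mathbf{x}^{(0)}$.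 *)

(* Defs.v *)
From HB Require Import structures.
From mathcomp Require Import all_boot all_order all_algebra.
From mathcomp Require Import boolp classical_sets.

Set Implicit Arguments.
Unset Strict Implicit.
Unset Printing Implicit Defensive.

Import Order.TTheory GRing.Theory Num.Theory.
Local Open Scope classical_set_scope.
Local Open Scope ring_scope.

(* Z_p is the inverse limit of the rings Z/p^n: [residue x n] is the
   representative of x modulo p^n in {0, ..., p^n - 1}; this range constraint
   is implied by [residue_coherent].  Q_p is the fraction field of Z_p. *)
Record padic_int (p : nat) (p_pr : prime p) := PadicInt {
  residue :> nat -> nat;
  residue_coherent : forall n, residue n = (residue n.+1 %% p ^ n)%N }.

HB.instance Definition _ p (p_pr : prime p) := gen_eqMixin (padic_int p_pr).
HB.instance Definition _ p (p_pr : prime p) := gen_choiceMixin (padic_int p_pr).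

Section PadicIntegers.
Context (p : nat) (p_pr : prime p).
Local Notation Zp := (padic_int p_pr).
Implicit Types x y z : Zp.

Lemma padic_intP x y : (forall n, x n = y n) -> x = y.
Proof.
case: x y => [f Hf] [g Hg] /= /funext fg; subst g.
by rewrite (Prop_irrelevance Hf Hg).
Qed.

Lemma residue_mod x n : (x n %% p ^ n)%N = x n.
Proof. by rewrite [in LHS]residue_coherent modn_mod -residue_coherent. Qed.

Lemma residue_modD x n k : (x (n + k) %% p ^ n)%N = x n.
Proof.
elim: k => [|k IHk]; first by rewrite addn0 residue_mod.
rewrite -[RHS]IHk addnS (residue_coherent x (n + k)) modn_dvdm //.
by rewrite expnD dvdn_mulr.
Qed.

Lemma coherent_mod (u : nat -> nat) :
    (forall n, u n.+1 = u n %[mod p ^ n])%N ->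
  forall n, ((u n %% p ^ n) = (u n.+1 %% p ^ n.+1) %% p ^ n)%N.
Proof. by move=> Hu n; rewrite modn_dvdm ?Hu // expnS dvdn_mull. Qed.

Definition padic_int_of (u : nat -> nat)
    (Hu : forall n, (u n.+1 = u n %[mod p ^ n])%N) : Zp :=
  PadicInt p_pr (coherent_mod Hu).

Lemma residueS_mod x n : (x n.+1 = x n %[mod p ^ n])%N.
Proof. by rewrite residue_mod -residue_coherent. Qed.

Fact nat_coherent (a n : nat) : (a = a %[mod p ^ n])%N. Proof. by []. Qed.

Fact add_coherent x y n :
  (x n.+1 + y n.+1 = x n + y n %[mod p ^ n])%N.
Proof. by rewrite -modnDm !residueS_mod modnDm. Qed.

Fact mul_coherent x y n :
  (x n.+1 * y n.+1 = x n * y n %[mod p ^ n])%N.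
Proof. by rewrite -modnMm !residueS_mod modnMm. Qed.

(* - x, with -1 represented by p ^ n - 1 *)
Fact opp_coherent x n :
  ((p ^ n.+1).-1 * x n.+1 = (p ^ n).-1 * x n %[mod p ^ n])%N.
Proof.
have pn k : (0 < p ^ k)%N by rewrite expn_gt0 prime_gt0.
apply/eqP; rewrite -(eqn_modDr (x n.+1)) -mulSnr prednK // expnS -mulnA.
rewrite mulnCA modnMr -modnDmr residueS_mod modnDmr -mulSnr prednK //.
by rewrite modnMr.
Qed.

Definition padic_int_nat (a : nat) : Zp := padic_int_of (nat_coherent a).
Definition padic_int_add x y : Zp := padic_int_of (add_coherent x y).
Definition padic_int_mul x y : Zp := padic_int_of (mul_coherent x y).
Definition padic_int_opp x : Zp := padic_int_of (opp_coherent x).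

Fact padic_int_addA : associative padic_int_add.
Proof.
by move=> x y z; apply: padic_intP => n /=; rewrite modnDml modnDmr addnA.
Qed.
Fact padic_int_addC : commutative padic_int_add.
Proof. by move=> x y; apply: padic_intP => n /=; rewrite addnC. Qed.
Fact padic_int_add0 : left_id (padic_int_nat 0) padic_int_add.
Proof. by move=> x; apply: padic_intP => n /=; rewrite mod0n residue_mod. Qed.
Fact padic_int_addN :
  left_inverse (padic_int_nat 0) padic_int_opp padic_int_add.
Proof.
move=> x; apply: padic_intP => n /=.
by rewrite modnDml -mulSnr prednK ?expn_gt0 ?prime_gt0 // modnMr mod0n.
Qed.

HB.instance Definition _ := GRing.isZmodule.Build Zp
  padic_int_addA padic_int_addC padic_int_add0 padic_int_addN.

Fact padic_int_mulA : associative padic_int_mul.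
Proof.
by move=> x y z; apply: padic_intP => n /=; rewrite modnMml modnMmr mulnA.
Qed.
Fact padic_int_mulC : commutative padic_int_mul.
Proof. by move=> x y; apply: padic_intP => n /=; rewrite mulnC. Qed.
Fact padic_int_mul1 : left_id (padic_int_nat 1) padic_int_mul.
Proof.
by move=> x; apply: padic_intP => n /=; rewrite modnMml mul1n residue_mod.
Qed.
Fact padic_int_mulD : left_distributive padic_int_mul padic_int_add.
Proof.
by move=> x y z; apply: padic_intP => n /=; rewrite modnMml modnDm mulnDl.
Qed.
Fact padic_int_1neq0 : padic_int_nat 1 != 0.
Proof.
apply/eqP => /(congr1 (fun x : Zp => x 1)) /=.
by rewrite expn1 mod0n modn_small ?prime_gt1.
Qed.

HB.instance Definition _ := GRing.Zmodule_isComNzRing.Build Zp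
  padic_int_mulA padic_int_mulC padic_int_mul1 padic_int_mulD padic_int_1neq0.

Definition padic_int_unit : pred Zp := fun x => `[< exists y, y * x = 1 >].
Definition padic_int_inv x : Zp :=
  if padic_int_unit x then xget 0 [set y | y * x = 1] else x.

Fact padic_int_mulV : {in padic_int_unit, left_inverse 1 padic_int_inv *%R}.
Proof.
move=> x /[dup] /asboolP [y yx] xu; rewrite /padic_int_inv ifT //.
by case: xgetP => [//|/(_ y)].
Qed.
Fact padic_int_unitP x y : y * x = 1 -> padic_int_unit x.
Proof. by move=> yx; apply/asboolP; exists y. Qed.
Fact padic_int_inv_out : {in [predC padic_int_unit], padic_int_inv =1 id}.
Proof. by move=> x /negbTE xu; rewrite /padic_int_inv ifF. Qed.

HB.instance Definition _ := GRing.ComNzRing_hasMulInverse.Build Zp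
  padic_int_mulV padic_int_unitP padic_int_inv_out.

(* the exact power of p dividing x is p ^ n *)
Definition is_padic_val x (n : nat) : Prop := x n = 0%N /\ x n.+1 <> 0%N.

Lemma residue_eq0 x n N : (n <= N)%N -> (x n == 0%N) = (p ^ n %| x N)%N.
Proof. by move=> /subnKC <-; rewrite -(residue_modD x n (N - n)). Qed.

Lemma residue_eq0_le x n m : (m <= n)%N -> x n = 0%N -> x m = 0%N.
Proof. by move=> mn xn; apply/eqP; rewrite (residue_eq0 _ mn) xn dvdn0. Qed.

Lemma residue0 n : (0 : Zp) n = 0%N.
Proof. exact: mod0n. Qed.

Lemma residue_at0 x : x 0%N = 0%N.
Proof. by rewrite -(residue_mod x 0) expn0 modn1. Qed.

Lemma is_padic_val_ex x : x != 0 -> exists n, is_padic_val x n.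
Proof.
move=> x0; have [n xn] : exists n, x n != 0%N.
  apply: contrapT => H; move/eqP: x0; apply; apply: padic_intP => n.
  by rewrite residue0; apply: contrapT => /eqP xn; apply: H; exists n.
elim: n xn => [|n IHn]; first by rewrite residue_at0.
by have [xn xSn|xn _] := eqVneq (x n) 0%N; [exists n; split=> //; apply/eqP
  | apply: IHn].
Qed.

Lemma is_padic_val_uniq x n m : is_padic_val x n -> is_padic_val x m -> n = m.
Proof.
move=> [xn xSn] [xm xSm]; case: (ltngtP n m) => // [lt|lt].
  by case: xSn; apply: residue_eq0_le xm.
by case: xSm; apply: residue_eq0_le xn.
Qed.

Lemma is_padic_val_neq0 x n : is_padic_val x n -> x != 0.
Proof. by move=> [_ xSn]; apply/eqP => x0; apply: xSn; rewrite x0 residue0. Qed.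

Lemma is_padic_valE x n N : (n < N)%N ->
  is_padic_val x n <-> (0 < x N)%N /\ logn p (x N) = n.
Proof.
move=> nN; split=> [[xn xSn]|[xN0 xNn]].
  have xN0 : (0 < x N)%N.
    by rewrite lt0n; apply/eqP => xN; apply: xSn; apply: residue_eq0_le xN.
  split=> //; apply/eqP; rewrite eqn_leq -pfactor_dvdn //.
  rewrite -(residue_eq0 _ (ltnW nN)) xn eqxx andbT leqNgt -pfactor_dvdn //.
  by rewrite -(residue_eq0 _ nN); apply/eqP.
split; apply/eqP.
  by rewrite (residue_eq0 _ (ltnW nN)) pfactor_dvdn // xNn.
by rewrite (residue_eq0 _ nN) pfactor_dvdn // xNn ltnn.
Qed.

Lemma is_padic_valM x y n m :
  is_padic_val x n -> is_padic_val y m -> is_padic_val (x * y) (n + m).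
Proof.
set N := (n + m).+1.
have nN : (n < N)%N by rewrite ltnS leq_addr.
have mN : (m < N)%N by rewrite ltnS leq_addl.
move=> /(is_padic_valE _ nN)[xN0 xn] /(is_padic_valE _ mN)[yN0 ym].
have xyE k : (k <= N)%N -> ((x * y) k == 0%N) = (k <= n + m)%N.
  move=> kN; rewrite (residue_eq0 _ kN) /= /dvdn modn_dvdm ?dvdn_exp2l //.
  by rewrite -/(dvdn _ _) pfactor_dvdn ?muln_gt0 ?xN0 // lognM // xn ym.
by split; apply/eqP; rewrite xyE ?ltnn.
Qed.

Fact padic_int_integral : GRing.integral_domain_axiom Zp.
Proof.
move=> x y xy0; apply/norP => -[/is_padic_val_ex[n xn] /is_padic_val_ex[m ym]].
by have /is_padic_val_neq0/eqP := is_padic_valM xn ym.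
Qed.

HB.instance Definition _ :=
  GRing.ComUnitRing_isIntegral.Build Zp padic_int_integral.

Definition padic_val x : nat := xget 0%N (is_padic_val x).

(* All the values of the p-adic absolute value are rational. *)
Definition padic_int_norm x : rat :=
  if x == 0 then 0 else (p%:R ^+ padic_val x)^-1.

Lemma padic_valP x : x != 0 -> is_padic_val x (padic_val x).
Proof. by move=> /is_padic_val_ex; apply: xgetPex. Qed.

Lemma padic_val_eq x n : is_padic_val x n -> padic_val x = n.
Proof.
by move=> xn; exact: is_padic_val_uniq (padic_valP (is_padic_val_neq0 xn)) xn.
Qed.

Fact natp_gt0 : 0 < p%:R :> rat.
Proof. by rewrite ltr0n prime_gt0. Qed.

Lemma padic_int_norm_gt0 x : (0 < padic_int_norm x) = (x != 0).
Proof.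
rewrite /padic_int_norm; case: eqP => // _.
by rewrite invr_gt0 exprn_gt0 // natp_gt0.
Qed.

Lemma padic_int_norm_ge0 x : 0 <= padic_int_norm x.
Proof.
rewrite /padic_int_norm; case: eqP => // _.
by rewrite invr_ge0 exprn_ge0 // ltW // natp_gt0.
Qed.

Lemma padic_int_normM x y :
  padic_int_norm (x * y) = padic_int_norm x * padic_int_norm y.
Proof.
rewrite /padic_int_norm mulf_eq0.
have [|x0] := eqVneq x 0; first by rewrite mul0r.
have [|y0] := eqVneq y 0; first by rewrite mulr0.
rewrite (padic_val_eq (is_padic_valM (padic_valP x0) (padic_valP y0))).
by rewrite exprD invfM.
Qed.

Lemma padic_int_norm_le x n : (padic_int_norm x <= (p%:R ^+ n)^-1) <-> x n = 0%N.
Proof.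
have p1 : 1 < p%:R :> rat by rewrite ltr1n prime_gt1.
rewrite /padic_int_norm; have [->|x0] := eqVneq x 0.
  by rewrite residue0 invr_ge0 exprn_ge0 // ltW // natp_gt0.
have [xv xSv] := padic_valP x0.
rewrite lef_pV2 ?posrE ?exprn_gt0 ?natp_gt0 // ler_eXn2l //.
split=> [nv|xn]; first exact: residue_eq0_le xv.
by rewrite leqNgt; apply/negP => vn; apply: xSv; apply: residue_eq0_le xn.
Qed.

Lemma padic_int_normD x y :
  padic_int_norm (x + y) <= Num.max (padic_int_norm x) (padic_int_norm y).
Proof.
wlog le_xy : x y / padic_int_norm x <= padic_int_norm y.
  move=> IH.
  have /orP[/IH //|/IH] := le_total (padic_int_norm x) (padic_int_norm y).
  by rewrite addrC maxC.
rewrite (max_idPr le_xy); have [y0|y0] := eqVneq y 0.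
  by move: le_xy; rewrite y0 addr0.
have yE : padic_int_norm y = (p%:R ^+ padic_val y)^-1.
  by rewrite /padic_int_norm (negbTE y0).
move: le_xy; rewrite yE => /padic_int_norm_le xv; apply/padic_int_norm_le => /=.
by have [-> _] := padic_valP y0; rewrite xv mod0n.
Qed.

End PadicIntegers.

Lemma fracE (R : idomainType) (x : {fraction R}) :
  x = FracField.tofrac (\n_(repr x)) / FracField.tofrac (\d_(repr x)).
Proof.
rewrite -[LHS]reprK; set r := repr x.
unlock FracField.tofrac; rewrite -[_^-1]FracField.pi_inv -[RHS]FracField.pi_mul.
rewrite /FracField.mulf /FracField.invf.
by rewrite !numden_Ratio ?(oner_eq0, denom_ratioP) // mulr1 mul1r Ratio_numden.
Qed.

Notation padic p_pr := {fraction padic_int p_pr}.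

Section PadicNorm.
Context (p : nat) (p_pr : prime p).
Local Notation Zp := (padic_int p_pr).
Local Notation Qp := (padic p_pr).
Local Notation "a %:F" := (@FracField.tofrac Zp a) (at level 1).
Implicit Types x y : Qp.

Definition padic_norm x : rat :=
  let r := repr x in
  padic_int_norm (\n_r) / padic_int_norm (\d_r).

Lemma padic_normE (a b : Zp) : b != 0 ->
  padic_norm (a%:F / b%:F) = padic_int_norm a / padic_int_norm b.
Proof.
move=> b0; rewrite /padic_norm; set x : Qp := a%:F / b%:F.
have d0 := denom_ratioP (repr x).
have norm_neq0 (c : Zp) : c != 0 -> padic_int_norm c != 0.
  by rewrite -padic_int_norm_gt0 lt0r => /andP[].
apply/eqP; rewrite eqr_div ?norm_neq0 // -!padic_int_normM.
apply/eqP; congr padic_int_norm; apply/eqP; rewrite -tofrac_eq !tofracM.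
by rewrite -eqr_div ?tofrac_eq0 //; apply/eqP; rewrite -fracE.
Qed.

Lemma padic_fracP x : exists a b : Zp, b != 0 /\ x = a%:F / b%:F.
Proof.
by exists (\n_(repr x)), (\d_(repr x));
  split; [exact: denom_ratioP | exact: fracE].
Qed.

Lemma padic_normM x y : padic_norm (x * y) = padic_norm x * padic_norm y.
Proof.
have [a [b [b0 ->]]] := padic_fracP x; have [c [d [d0 ->]]] := padic_fracP y.
rewrite mulf_div -!tofracM !padic_normE ?mulf_neq0 // !padic_int_normM.
by rewrite mulf_div.
Qed.

Lemma padic_norm_eq0 x : (padic_norm x == 0) = (x == 0).
Proof.
have [a [b [b0 ->]]] := padic_fracP x.
have norm0 (c : Zp) : (padic_int_norm c == 0) = (c == 0).
  by rewrite -[RHS]negbK -padic_int_norm_gt0 lt0r padic_int_norm_ge0 andbT negbK.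
by rewrite padic_normE // !mulf_eq0 !invr_eq0 !tofrac_eq0 !norm0.
Qed.

Lemma padic_normD x y :
  padic_norm (x + y) <= Num.max (padic_norm x) (padic_norm y).
Proof.
have [a [b [b0 ->]]] := padic_fracP x; have [c [d [d0 ->]]] := padic_fracP y.
have fb0 : b%:F != 0 by rewrite tofrac_eq0.
have fd0 : d%:F != 0 by rewrite tofrac_eq0.
have nb0 : 0 < padic_int_norm b by rewrite padic_int_norm_gt0.
have nd0 : 0 < padic_int_norm d by rewrite padic_int_norm_gt0.
rewrite addf_div // -!tofracM -tofracD !padic_normE ?mulf_neq0 //.
rewrite padic_int_normM ler_pdivrMr ?mulr_gt0 //.
rewrite maxr_pMl ?mulr_ge0 ?padic_int_norm_ge0 //.
rewrite [_ / _ * _]mulrA divfK ?gt_eqF // [padic_int_norm b * _]mulrC.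
rewrite [_ / _ * _]mulrA divfK ?gt_eqF // -!padic_int_normM.
exact: padic_int_normD.
Qed.

Lemma padic_norm_p : padic_norm p%:R = p%:R^-1.
Proof.
have natE k : (k%:R : Zp) = padic_int_nat p_pr k.
  elim: k => [//|k IHk]; rewrite -natr1 IHk; apply: padic_intP => n /=.
  by rewrite modnDm addn1.
have pv : is_padic_val (p%:R : Zp) 1.
  rewrite natE; split=> /=; first by rewrite expn1 modnn.
  apply/eqP; rewrite -lt0n modn_small ?prime_gt0 // -[X in (X < _)%N]expn1.
  by rewrite ltn_exp2l ?prime_gt1.
rewrite -[p%:R]divr1 -(rmorph_nat (@FracField.tofrac Zp)) -(tofrac1 Zp).
rewrite padic_normE ?oner_eq0 // /padic_int_norm oner_eq0.
have v1 : is_padic_val (1 : Zp) 0.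
  split; first exact: residue_at0.
  by rewrite /= modn_small ?expn1 ?prime_gt1.
rewrite (negbTE (is_padic_val_neq0 pv)) (padic_val_eq pv) (padic_val_eq v1).
by rewrite expr0 expr1 invr1 divr1.
Qed.

End PadicNorm.

Section PottsBethe.
Context (p : nat) (p_pr : prime p).
Local Notation Qp := (padic p_pr).

Definition padic_cvg (u : nat -> Qp) (l : Qp) : Prop :=
  forall eps : rat, 0 < eps ->
    exists N : nat, forall n, (N <= n)%N -> padic_norm (u n - l) < eps.

Context (theta : Qp) (q : nat).

Definition x_infty : Qp := 2%:R - theta - q%:R.

(* [None] stands for "undefined". *)
Definition potts_bethe (x : Qp) : option Qp :=
  if x == x_infty then None
  else Some (((theta * x + q%:R - 1) / (x + theta + q%:R - 2%:R)) ^+ 3).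

Definition potts_bethe_iter (n : nat) (x : Qp) : option Qp :=
  iter n (obind potts_bethe) (Some x).

Definition potts_bethe_preimage (n : nat) (S : set Qp) : set Qp :=
  [set x | exists2 y, potts_bethe_iter n x = Some y & S y].

Definition basin (x0 : Qp) : set Qp :=
  [set x | exists2 u : nat -> Qp,
     forall n, potts_bethe_iter n x = Some (u n) & padic_cvg u x0].

Definition potts_cubic (y : Qp) : Qp :=
  y ^+ 3 - (1 + theta + theta ^+ 2) * y ^+ 2
    - (2%:R * theta + 1) * (1 - theta - q%:R) * y - (1 - theta - q%:R) ^+ 2.

(* the unique root of [potts_cubic]; 0 if there is no such thing *)
Definition y_1 : Qp := xget 0 (unique (fun y => potts_cubic y = 0)).

Definition x_1 : Qp := 1 - q%:R + (theta - 1) * (y_1 - 1).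

End PottsBethe.

(* Main.v *)
Require Import Defs.
From mathcomp Require Import all_boot all_order all_algebra.
From mathcomp Require Import ring.
From mathcomp Require Import boolp classical_sets.

Set Implicit Arguments.
Unset Strict Implicit.
Unset Printing Implicit Defensive.

Import Order.TTheory GRing.Theory Num.Theory.
Local Open Scope classical_set_scope.
Local Open Scope ring_scope.

(** Put d = theta - 1 and c = 1 - theta - q, so that |d| < |c| = |q| < 1, and
    follow u = x - 1.  The fixed point 1 becomes 0, the singular point becomes
    c, and the mapping becomes u |-> (1 + h)^3 - 1 with h = d u / (u - c).
    Since p = 2 mod 3, the polynomial X^2 + X + 1 has no root modulo p, hence
    |g^2 + g + 1| = 1 whenever |g| <= 1 ([padic_norm_cyclotomic3]).  As
    (1 + h)^3 - 1 = h (g^2 + g + 1) with g = 1 + h, the size of the image is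
    read off from |h|:
    - if |u| < |c|, the image has norm |d / c| |u|, so the orbit tends to 0;
    - if |u| > |c|, the image has norm |d| < |c|, which is the first case;
    - if |u| = |c| but |u - c| <> |d|, the image has norm different from |c|.
    So an orbit that never meets the singularity and does not converge to 0
    satisfies |u - c| = |d| for ever ([orbit_enters_or_stays]).

    On the sphere |u - c| = |d| the mapping multiplies distances by
    |c / d| > 1 ([step_expands]), while two points of the sphere are at most
    |d| apart.  Two orbits that stay on the sphere are therefore equal;
    [sphere_orbit_unique] is the case where one of them is constant.  The
    constant orbits in question are the c + d y where y is a root of the cubic:
    the fixed points other than 0 are exactly these.  The root exists because y |-> (cubic tail) / y^2 is a contraction of
    the complete unit sphere ([cubic_root_ex]), and it is unique because
    c + d y is an orbit on the sphere ([cubic_root_unique]).  The complement of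
    the basin thus consists of x^(1) and of the points that eventually hit the
    singularity.

    The dynamical argument is carried out over an arbitrary field with an
    ultrametric absolute value: what it needs of Q_p is discreteness and
    completeness of the norm, and the absence of primitive cube roots of unity
    modulo p. *)

(** * Non-archimedean absolute values *)

Record ultrametric (F : fieldType) (N : F -> rat) : Prop := Ultrametric {
  ultra_ge0 : forall x, 0 <= N x;
  ultra_eq0 : forall x, (N x == 0) = (x == 0);
  ultraM : forall x y, N (x * y) = N x * N y;
  ultraD : forall x y, N (x + y) <= Num.max (N x) (N y) }.

Section Ultrametric.
Context (F : fieldType) (N : F -> rat) (ultraN : ultrametric N).
Implicit Types x y : F.

Lemma ultra0 : N 0 = 0.
Proof. by apply/eqP; rewrite (ultra_eq0 ultraN). Qed.

Lemma ultra_gt0 x : (0 < N x) = (x != 0).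
Proof. by rewrite lt0r (ultra_eq0 ultraN) (ultra_ge0 ultraN) andbT. Qed.

Lemma ultra1 : N 1 = 1.
Proof.
have N1 : N 1 != 0 by rewrite (ultra_eq0 ultraN) oner_eq0.
by apply: (mulfI N1); rewrite -(ultraM ultraN) !mulr1.
Qed.

Lemma ultraV x : N x^-1 = (N x)^-1.
Proof.
have [->|x0] := eqVneq x 0; first by rewrite invr0 ultra0 invr0.
have Nx : N x != 0 by rewrite (ultra_eq0 ultraN).
by apply: (mulfI Nx); rewrite -(ultraM ultraN) !divff // ultra1.
Qed.

Lemma ultraX x n : N (x ^+ n) = N x ^+ n.
Proof.
by elim: n => [|n IHn]; rewrite ?ultra1 // !exprS (ultraM ultraN) IHn.
Qed.

Lemma ultraNeg x : N (- x) = N x.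
Proof.
suff NN1 : N (-1) = 1 by rewrite -mulN1r (ultraM ultraN) NN1 mul1r.
apply/eqP; rewrite -(@pexpr_eq1 _ _ 2) ?(ultra_ge0 ultraN) //.
by rewrite -ultraX sqrrN expr1n ultra1.
Qed.

Lemma ultraBC x y : N (x - y) = N (y - x).
Proof. by rewrite -ultraNeg opprB. Qed.

Lemma ultraD_le r x y : N x <= r -> N y <= r -> N (x + y) <= r.
Proof.
by move=> xr yr; apply: le_trans (ultraD ultraN x y) _; rewrite ge_max xr.
Qed.

Lemma ultraD_lt r x y : N x < r -> N y < r -> N (x + y) < r.
Proof.
by move=> xr yr; apply: le_lt_trans (ultraD ultraN x y) _; rewrite gt_max xr.
Qed.

Lemma ultraB_le r x y : N x <= r -> N y <= r -> N (x - y) <= r.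
Proof. by move=> xr yr; apply: ultraD_le; rewrite ?ultraNeg. Qed.

(** Every triangle is isosceles: otherwise x = (x + y) - y would be smaller than
    itself. *)
Lemma ultraD_dom x y : N y < N x -> N (x + y) = N x.
Proof.
move=> yx; apply/le_anti; rewrite ultraD_le ?(ltW yx) //= leNgt.
apply/negP => xyx; have := ultraD_lt xyx (_ : N (- y) < N x).
by rewrite addrK ltxx ultraNeg => /(_ yx).
Qed.

Lemma ultraDr_dom x y : N x < N y -> N (x + y) = N y.
Proof. by rewrite addrC; apply: ultraD_dom. Qed.

Lemma ultra_nat n : N n%:R <= 1.
Proof.
elim: n => [|n IHn]; first by rewrite ultra0.
by rewrite -natr1 ultraD_le // ultra1.
Qed.

End Ultrametric.

(** * The mapping in the coordinate centred at its attracting fixed point *)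

(** With x = 1 + u and c = 1 - theta - q, the base of the cube in the mapping is
    1 + [pb_ratio]: numerator minus denominator is (theta - 1) (x - 1), and the
    denominator is u - c. *)
Definition pb_ratio (F : fieldType) (th c u : F) : F := (th - 1) * u / (u - c).

Definition pb_step (F : fieldType) (th c u : F) : F :=
  (1 + pb_ratio th c u) ^+ 3 - 1.

Definition pb_cubic (F : fieldType) (th c y : F) : F :=
  y ^+ 3 - (1 + th + th ^+ 2) * y ^+ 2 - (2%:R * th + 1) * c * y - c ^+ 2.

(** The right-hand side of the cubic equation solved for its leading term and
    divided by y^2: the nonzero roots of the cubic are its fixed points. *)
Definition pb_contraction (F : fieldType) (th c y : F) : F :=
  1 + th + th ^+ 2 + (2%:R * th + 1) * c / y + (c / y) ^+ 2.

Section Dynamics.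
Context (F : fieldType) (N : F -> rat) (ultraN : ultrametric N).
(** For Q_p, b = p.  No norm lies strictly between 1 / b and 1, and sequences of
    the unit ball that are Cauchy at the rate b^-n converge; the last hypothesis
    says that the residue field has no primitive cube root of unity and is not
    of characteristic 3. *)
Context (b : nat) (b_gt1 : (1 < b)%N).
Hypothesis discreteN : forall x, N x < 1 -> N x <= (b%:R ^+ 1)^-1.
Hypothesis completeN : forall v : nat -> F, (forall n, N (v n) <= 1) ->
  (forall n, N (v n.+1 - v n) <= (b%:R ^+ n)^-1) ->
  exists l, forall n, N (v n - l) <= (b%:R ^+ n)^-1.
Hypothesis norm_cyclotomic3 : forall g, N g <= 1 -> N (g ^+ 2 + g + 1) = 1.

Lemma powV_lt (e : rat) : 0 < e ->
  exists n, forall m, (n <= m)%N -> (b%:R ^+ m)^-1 < e.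
Proof.
move=> e0; exists (Num.bound e^-1) => m nm.
have b0 : 0 < b%:R :> rat by rewrite ltr0n ltnW.
rewrite -[e]invrK ltf_pV2 ?posrE ?invr_gt0 ?exprn_gt0 //.
apply: lt_le_trans (archi_boundP _) _; first by rewrite invr_ge0 ltW.
by rewrite -natrX ler_nat (leq_trans nm) // ltnW // ltn_expl.
Qed.

Lemma powVS n : (b%:R ^+ n.+1)^-1 = (b%:R ^+ 1)^-1 * (b%:R ^+ n)^-1 :> rat.
Proof. by rewrite -invfM -exprD. Qed.

Lemma powV_ge0 n : 0 <= (b%:R ^+ n)^-1 :> rat.
Proof. by rewrite invr_ge0 exprn_ge0. Qed.

Lemma powV1_lt1 : (b%:R ^+ 1)^-1 < 1 :> rat.
Proof. by rewrite invf_lt1 ?ltr1n ?ltr0n // ltnW. Qed.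

Lemma ultra_small_eq0 x : (forall n, N x <= (b%:R ^+ n)^-1) -> x = 0.
Proof.
move=> xs; apply: contrapT => /eqP; rewrite -(ultra_gt0 ultraN) => /powV_lt.
by move=> [n /(_ n (leqnn n))]; rewrite ltNge xs.
Qed.

Context (th c : F).
Local Notation d := (th - 1).
Local Notation h := (pb_ratio th c).
Local Notation step := (pb_step th c).
Local Notation T := (pb_contraction th c).
Hypothesis d0 : d != 0.
Hypothesis dc : N d < N c.
Hypothesis c1 : N c < 1.

Lemma c_gt0 : 0 < N c.
Proof. exact: le_lt_trans (ultra_ge0 ultraN _) dc. Qed.

Lemma c_neq0 : c != 0.
Proof. by rewrite -(ultra_gt0 ultraN) c_gt0. Qed.

Lemma d_gt0 : 0 < N d.
Proof. by rewrite (ultra_gt0 ultraN). Qed.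

Lemma pb_stepE u : step u = h u * ((1 + h u) ^+ 2 + (1 + h u) + 1).
Proof. by rewrite /pb_step; ring. Qed.

Lemma norm_ratio u : N (h u) = N d * N u / N (u - c).
Proof. by rewrite /pb_ratio !(ultraM ultraN) (ultraV ultraN). Qed.

(** If |h| < 1 the factor g^2 + g + 1 of the step has norm 1. *)
Lemma norm_step_small u : N (h u) < 1 -> N (step u) = N (h u).
Proof.
move=> h1; rewrite pb_stepE (ultraM ultraN) norm_cyclotomic3 ?mulr1 //.
by rewrite (ultraD_le ultraN) ?(ultra1 ultraN) // ltW.
Qed.

(** Here g = 1 + h may be large, and then the factor g^2 + g + 1 is dominated by
    g^2; in both cases that factor has norm at least 1. *)
Lemma norm_step_large u : 1 <= N (h u) -> 1 <= N (step u).
Proof.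
move=> h1; rewrite pb_stepE (ultraM ultraN).
set g := 1 + h u; have [g1|g1] := leP (N g) 1.
  by rewrite norm_cyclotomic3 ?mulr1.
have g2 : N g < N (g ^+ 2).
  by rewrite (ultraX ultraN) expr2 ltr_pMl // (lt_trans ltr01).
have gg : N (g ^+ 2 + g) = N (g ^+ 2) by apply: ultraD_dom.
rewrite (ultraD_dom ultraN) gg ?(ultra1 ultraN) ?(lt_trans g1) //.
by rewrite mulr_ege1 // ltW // (lt_trans g1).
Qed.

Lemma norm_step_inside u : N u < N c -> N (step u) = N (d / c) * N u.
Proof.
move=> uc.
have hE : N (h u) = N (d / c) * N u.
  rewrite norm_ratio [N (u - c)](ultraDr_dom ultraN) ?(ultraNeg ultraN) //.
  by rewrite (ultraM ultraN) (ultraV ultraN) mulrAC.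
rewrite norm_step_small hE //.
have dc1 : N (d / c) < 1.
  by rewrite (ultraM ultraN) (ultraV ultraN) ltr_pdivrMr ?mul1r ?c_gt0.
rewrite (le_lt_trans _ (lt_trans uc c1)) // ler_piMl ?(ultra_ge0 ultraN) //.
exact: ltW.
Qed.

Lemma norm_step_outside u : N c < N u -> N (step u) = N d.
Proof.
move=> cu.
have u0 : N u != 0 by rewrite gt_eqF // (lt_trans c_gt0).
have hE : N (h u) = N d.
  by rewrite norm_ratio [N (u - c)](ultraD_dom ultraN) ?(ultraNeg ultraN) //
     mulfK.
by rewrite norm_step_small hE // (lt_trans dc).
Qed.

(** If |h| >= 1 the image has norm at least 1 > |c|.  Otherwise it has norm
    |h| = |d| |c| / |u - c|, which equals |c| only when |u - c| = |d|. *)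
Lemma norm_step_sphere u : u != c -> N u = N c -> N (u - c) != N d ->
  N (step u) != N c.
Proof.
rewrite -subr_eq0 -(ultra_gt0 ultraN) => uc0 uc ucd.
have [h1|h1] := ltP (N (h u)) 1; last first.
  by rewrite gt_eqF // (lt_le_trans c1) // norm_step_large.
rewrite norm_step_small // norm_ratio uc; apply: contraNneq ucd => E.
have : N d * N c = N c * N (u - c) by rewrite -[in RHS]E divfK ?gt_eqF.
by rewrite mulrC => /(mulfI (lt0r_neq0 c_gt0)) ->.
Qed.

(** A point that leaves the sphere |u| = |c| enters the ball |u| < |c| at once
    or at the next step. *)
Lemma orbit_enters_or_stays (w : nat -> F) :
    (forall n, w n != c) -> (forall n, w n.+1 = step (w n)) ->
  (exists m, N (w m) < N c) \/ (forall n, N (w n - c) = N d).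
Proof.
move=> wc ws; have [|out] := pselect (exists m, N (w m) < N c); first by left.
right=> n; apply/eqP; apply: contrapT => /negP wnd; apply: out.
have exits m : N (w m) != N c -> exists k, N (w k) < N c.
  case: (ltgtP (N (w m)) (N c)) => // [wm _|wm _]; first by exists m.
  by exists m.+1; rewrite ws norm_step_outside.
have [wn|wn] := eqVneq (N (w n)) (N c); last exact: exits wn.
by apply: (exits n.+1); rewrite ws norm_step_sphere.
Qed.

Lemma norm_dc : N (d / c) <= (b%:R ^+ 1)^-1.
Proof.
apply: discreteN.
by rewrite (ultraM ultraN) (ultraV ultraN) ltr_pdivrMr ?mul1r ?c_gt0.
Qed.

Lemma orbit_inside_cvg (w : nat -> F) m :
    (forall n, w n.+1 = step (w n)) -> N (w m) < N c ->
  forall e : rat, 0 < e -> exists M, forall n, (M <= n)%N -> N (w n) < e.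
Proof.
move=> ws wm e /powV_lt[M MP].
have decay k : N (w (m + k)%N) < N c /\ N (w (m + k)%N) <= (b%:R ^+ k)^-1.
  elim: k => [|k [IHc IHk]].
    by rewrite addn0 invr1; split=> //; rewrite ltW // (lt_trans wm).
  rewrite addnS ws norm_step_inside //; split; last first.
    by rewrite powVS ler_pM ?(ultra_ge0 ultraN) ?norm_dc.
  apply: le_lt_trans IHc; rewrite ler_piMl ?(ultra_ge0 ultraN) //.
  by rewrite ltW // (le_lt_trans norm_dc) // powV1_lt1.
exists (m + M)%N => n mn; rewrite -(subnKC (leq_trans (leq_addr M m) mn)).
have [_ le] := decay (n - m)%N; apply: le_lt_trans le (MP _ _).
by rewrite leq_subRL // (leq_trans (leq_addr M m)).
Qed.

Lemma norm3 : N 3%:R = 1.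
Proof.
rewrite -(norm_cyclotomic3 (g := 1)) ?(ultra1 ultraN) //.
by congr N; rewrite expr1n; ring.
Qed.

(** The first factor is h u - h v.  The second one comes from the difference of
    cubes X^2 + X Y + Y^2 with X = 1 + h u and Y = 1 + h v, and is 3 up to a
    small term when h u and h v are small. *)
Lemma step_diff u v : u != c -> v != c ->
  let m := 3%:R * (h u + h v) + (h u ^+ 2 + h u * h v + h v ^+ 2) in
  step u - step v = d * c * (v - u) / ((u - c) * (v - c)) * (3%:R + m).
Proof.
rewrite -subr_eq0 -[v == c]subr_eq0 => uc vc /=.
have -> : d * c * (v - u) / ((u - c) * (v - c)) = h u - h v.
  by rewrite /pb_ratio; field; rewrite uc vc.
by rewrite /pb_step; ring.
Qed.

Lemma ratio_sphere u : N u = N c -> N (u - c) = N d -> N (h u) = N c.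
Proof.
by move=> uc ud; rewrite norm_ratio uc ud mulrAC divff ?mul1r ?gt_eqF ?d_gt0.
Qed.

Lemma sphere_norm u : N (u - c) = N d -> N u = N c.
Proof.
by move=> ud; rewrite -(subrK c u) (ultraDr_dom ultraN) ?ud.
Qed.

(** On this sphere |h| = |c| < 1 at both points, so that only the factor
    d c (v - u) / ((u - c) (v - c)) of [step_diff] contributes, and there both
    denominators have norm |d|. *)
Lemma step_expands u v : N (u - c) = N d -> N (v - c) = N d ->
  N (u - v) = N (d / c) * N (step u - step v).
Proof.
move=> ud vd; have nz x : N (x - c) = N d -> x != c.
  by move=> xd; rewrite -subr_eq0 -(ultra_gt0 ultraN) xd d_gt0.
rewrite step_diff ?nz //; set m := (X in 3%:R + X).
have hu : N (h u) < 1 by rewrite (ratio_sphere (sphere_norm ud) ud).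
have hv : N (h v) < 1 by rewrite (ratio_sphere (sphere_norm vd) vd).
have mul_lt x y : N x < 1 -> N y <= 1 -> N (x * y) < 1.
  move=> x1 y1; rewrite (ultraM ultraN) (le_lt_trans _ x1) //.
  by rewrite ler_piMr ?(ultra_ge0 ultraN).
have m1 : N m < 1.
  rewrite /m [3%:R * _]mulrC !expr2.
  have hsum : N (h u + h v) < 1 by apply: ultraD_lt.
  by do !apply: (ultraD_lt ultraN); apply: mul_lt; rewrite ?norm3 // ltW.
rewrite !(ultraM ultraN) [N (3%:R + m)](ultraD_dom ultraN) ?norm3 //.
rewrite !(ultraV ultraN) (ultraM ultraN) ud vd (ultraBC ultraN v).
by field; rewrite !gt_eqF ?c_gt0 ?d_gt0.
Qed.

(** Going n steps ahead multiplies the distance by |c / d|^n, yet it remains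
    bounded: the distance is at most b^-k for every k. *)
Lemma sphere_orbit_unique (w : nat -> F) v : (forall n, w n.+1 = step (w n)) ->
    (forall n, N (w n - c) = N d) -> step v = v -> N (v - c) = N d ->
  w 0%N = v.
Proof.
move=> ws wd vs vd; apply/eqP; rewrite -subr_eq0; apply/eqP.
suff close k n : N (w n - v) <= (b%:R ^+ k)^-1.
  by apply: ultra_small_eq0 => k; apply: close.
elim: k n => [|k IHk] n.
  rewrite invr1 -(subrKA c) (ultraD_le ultraN) //.
    by rewrite wd ltW // (lt_trans dc).
  by rewrite (ultraBC ultraN) vd ltW // (lt_trans dc).
rewrite step_expands // vs -ws powVS.
by rewrite ler_pM ?(ultra_ge0 ultraN) ?norm_dc.
Qed.

Lemma norm_th : N th = 1.
Proof.
by rewrite -(subrK 1 th) (ultraDr_dom ultraN) ?(ultra1 ultraN) // (lt_trans dc).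
Qed.

Lemma contraction_root y : y != 0 -> (pb_cubic th c y = 0) <-> (T y = y).
Proof.
move=> y0; have -> : pb_cubic th c y = (y - T y) * y ^+ 2.
  by rewrite /pb_cubic /pb_contraction; field.
split=> [/eqP|->]; last by rewrite subrr mul0r.
by rewrite mulf_eq0 expf_eq0 /= (negbTE y0) orbF subr_eq0 => /eqP.
Qed.

(** The term 1 + th + th^2 has norm 1, and the two other terms
    contain the small factor c. *)
Lemma norm_contraction y : 1 <= N y -> N (T y) = 1.
Proof.
move=> y1; have yi : N y^-1 <= 1.
  by rewrite (ultraV ultraN) invf_le1 // (lt_le_trans ltr01).
have cy : N (c / y) < 1.
  by rewrite (ultraM ultraN) (le_lt_trans _ c1) // ler_piMr ?(ultra_ge0 ultraN).
have a1 : N (1 + th + th ^+ 2) = 1.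
  by rewrite addrC [1 + th]addrC addrA norm_cyclotomic3 // norm_th.
rewrite /pb_contraction -addrA (ultraD_dom ultraN) a1 //.
apply: (ultraD_lt ultraN); last first.
  by rewrite (ultraX ultraN) expr_lt1 ?(ultra_ge0 ultraN).
rewrite -mulrA (ultraM ultraN) (le_lt_trans _ cy) //.
rewrite ler_piMl ?(ultra_ge0 ultraN) // (ultraD_le ultraN) ?(ultra1 ultraN) //.
by rewrite (ultraM ultraN) norm_th mulr1 (ultra_nat ultraN).
Qed.

Lemma contraction_lip y z : N y = 1 -> N z = 1 ->
  N (T y - T z) <= (b%:R ^+ 1)^-1 * N (y - z).
Proof.
move=> y1 z1.
have y0 : y != 0 by rewrite -(ultra_gt0 ultraN) y1.
have z0 : z != 0 by rewrite -(ultra_gt0 ultraN) z1.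
have -> : T y - T z = c * (z - y) *
    ((2%:R * th + 1) / (y * z) + c * (z + y) / (y * z) ^+ 2).
  by rewrite /pb_contraction; field; rewrite y0 z0.
rewrite (ultraM ultraN) [N (c * _)](ultraM ultraN) (ultraBC ultraN z).
have yz1 : N (y * z) = 1 by rewrite (ultraM ultraN) y1 z1 mulr1.
have bracket1 :
  N ((2%:R * th + 1) / (y * z) + c * (z + y) / (y * z) ^+ 2) <= 1.
  apply: (ultraD_le ultraN); rewrite (ultraM ultraN) (ultraV ultraN).
    rewrite yz1 divr1 (ultraD_le ultraN) ?(ultra1 ultraN) //.
    by rewrite (ultraM ultraN) norm_th mulr1 (ultra_nat ultraN).
  rewrite (ultraX ultraN) yz1 expr1n divr1 (ultraM ultraN).
  rewrite mulr_ile1 ?(ultra_ge0 ultraN) ?(ltW c1) //.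
  by rewrite (ultraD_le ultraN) ?y1 ?z1.
apply: le_trans (_ : N c * N (y - z) <= _).
  by rewrite ler_piMr ?mulr_ge0 ?(ultra_ge0 ultraN).
by rewrite ler_wpM2r ?(ultra_ge0 ultraN) ?discreteN.
Qed.

(** The iterates of the contraction from 1 stay on the unit sphere, and form a
    Cauchy sequence there whose limit is fixed. *)
Lemma cubic_root_ex : exists y, pb_cubic th c y = 0.
Proof.
pose v n := iter n T 1.
have v1 n : N (v n) = 1.
  by elim: n => [|n IHn]; rewrite ?(ultra1 ultraN) //= norm_contraction ?IHn.
have v_cauchy n : N (v n.+1 - v n) <= (b%:R ^+ n)^-1.
  elim: n => [|n IHn].
    by rewrite invr1 (ultraB_le ultraN) ?v1.
  rewrite powVS; apply: le_trans (contraction_lip (v1 n.+1) (v1 n)) _.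
  by rewrite ler_wpM2l ?powV_ge0.
have [n|l vl] := completeN _ v_cauchy; first by rewrite v1.
have l1 : N l = 1.
  have vl1 : N (l - v 1%N) < N (v 1%N).
    by rewrite (ultraBC ultraN) v1 (le_lt_trans (vl 1%N)) ?powV1_lt1.
  by rewrite -(subrKC (v 1%N) l) (ultraD_dom ultraN vl1) v1.
have l0 : l != 0 by rewrite -(ultra_gt0 ultraN) l1.
exists l; apply/contraction_root => //.
apply/eqP; rewrite -subr_eq0; apply/eqP; apply: ultra_small_eq0 => n.
rewrite -(subrKA (v n.+1)); apply: (ultraD_le ultraN).
  apply: le_trans (contraction_lip l1 (v1 n)) _.
  rewrite (ultraBC ultraN); apply: le_trans (vl n).
  rewrite ler_piMl ?(ultra_ge0 ultraN) //.
  by rewrite ltW ?powV1_lt1.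
apply: le_trans (vl n.+1) _; rewrite powVS ler_piMl ?powV_ge0 //.
by rewrite ltW ?powV1_lt1.
Qed.

Lemma cubic_root_neq0 y : pb_cubic th c y = 0 -> y != 0.
Proof.
apply: contra_eq_neq => ->.
by rewrite /pb_cubic !expr0n !mulr0 !subr0 sub0r oppr_eq0 expf_neq0 ?c_neq0.
Qed.

Lemma cubic_root_fixed y : pb_cubic th c y = 0 -> step (c + d * y) = c + d * y.
Proof.
move=> root_y; have y0 := cubic_root_neq0 root_y.
have E : step (c + d * y) - (c + d * y) =
    - ((d * y + c) * pb_cubic th c y / y ^+ 3).
  rewrite /pb_step /pb_ratio /pb_cubic; field; rewrite y0 /=.
  by rewrite addrAC subrr add0r mulf_neq0.
by apply/eqP; rewrite -subr_eq0 E root_y mulr0 mul0r oppr0.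
Qed.

(** The constant orbit at c + d y either stays on the sphere |u - c| = |d|,
    which is the claim, or converges to 0.  In the second case c + d y = 0, so
    that |y| = |c / d| > 1, but a fixed point of the contraction that lies
    outside the open unit ball has norm 1. *)
Lemma cubic_root_norm y : pb_cubic th c y = 0 -> N y = 1.
Proof.
move=> root_y; have y0 := cubic_root_neq0 root_y.
have yT : T y = y by apply/contraction_root.
have yfix := cubic_root_fixed root_y.
have yc : c + d * y != c.
  by rewrite -subr_eq0 addrAC subrr add0r mulf_neq0.
have w_fix (n : nat) : c + d * y = step (c + d * y) by [].
have [[m wm]|/(_ 0%N)] :=
  @orbit_enters_or_stays (fun=> c + d * y) (fun=> yc) w_fix.
- have cv := @orbit_inside_cvg (fun=> c + d * y) m w_fix wm.
  have y_c : c + d * y = 0.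
    have [//|] := eqVneq (c + d * y) 0; rewrite -(ultra_gt0 ultraN).
    by move=> y_gt0; have [M /(_ M (leqnn M))] := cv _ y_gt0; rewrite ltxx.
  have cy : N c = N d * N y.
    by rewrite -(ultraM ultraN); move/eqP: y_c; rewrite addr_eq0 => /eqP ->;
      rewrite (ultraNeg ultraN).
  rewrite -yT norm_contraction // leNgt; apply/negP => y1.
  have := dc; rewrite cy ltNge => /negP[].
  by rewrite ler_piMr ?(ultra_ge0 ultraN) // ltW.
rewrite addrAC subrr add0r (ultraM ultraN) => /eqP.
by rewrite -subr_eq0 -{2}[N d]mulr1 -mulrBr mulf_eq0 gt_eqF ?d_gt0 //= subr_eq0
  => /eqP.
Qed.

Lemma cubic_root_sphere y : pb_cubic th c y = 0 -> N (c + d * y - c) = N d.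
Proof.
move=> /cubic_root_norm y1.
by rewrite addrAC subrr add0r (ultraM ultraN) y1 mulr1.
Qed.

Lemma cubic_root_unique y z : pb_cubic th c y = 0 -> pb_cubic th c z = 0 ->
  y = z.
Proof.
move=> ry rz; apply: (mulfI d0); apply: (addrI c).
apply: (@sphere_orbit_unique (fun=> c + d * y)).
- by move=> _; rewrite cubic_root_fixed.
- by move=> _; rewrite cubic_root_sphere.
- exact: cubic_root_fixed.
exact: cubic_root_sphere.
Qed.

End Dynamics.

(** * The field of p-adic numbers *)

Section Padic.
Context (p : nat) (p_pr : prime p).
Local Notation Zp := (padic_int p_pr).
Local Notation Qp := (padic p_pr).
Local Notation N := (@padic_norm p p_pr).
Local Notation "a %:F" := (@FracField.tofrac Zp a) (at level 1).

Lemma padic_ultrametric : ultrametric N.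
Proof.
split; [| exact: padic_norm_eq0 | exact: padic_normM | exact: padic_normD].
by move=> x; rewrite /padic_norm divr_ge0 ?padic_int_norm_ge0.
Qed.
Local Notation uN := padic_ultrametric.

Lemma residueD (x y : Zp) n : (x + y) n = ((x n + y n) %% p ^ n)%N.
Proof. by []. Qed.

Lemma residueM (x y : Zp) n : (x * y) n = ((x n * y n) %% p ^ n)%N.
Proof. by []. Qed.

Lemma residue_nat k n : (k%:R : Zp) n = (k %% p ^ n)%N.
Proof.
elim: k => [|k IHk]; first by rewrite residue0 mod0n.
by rewrite -natr1 residueD IHk modnDm addn1.
Qed.

Lemma padic_norm_tofrac (a : Zp) : N a%:F = padic_int_norm a.
Proof.
have := padic_normE a (oner_neq0 Zp); rewrite tofrac1 divr1 => ->.
rewrite -[X in _ / padic_int_norm X](mulr1 1) padic_int_normM.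
have n1 : padic_int_norm (1 : Zp) != 0.
  by rewrite gt_eqF // padic_int_norm_gt0 oner_neq0.
have : padic_int_norm (1 : Zp) * padic_int_norm (1 : Zp)
     = padic_int_norm (1 : Zp) * 1 by rewrite -padic_int_normM !mulr1.
by move/(mulfI n1) => ->; rewrite mulr1 divr1.
Qed.

Lemma residue_eq_norm (a b : Zp) n :
  N (a%:F - b%:F) <= (p%:R ^+ n)^-1 <-> a n = b n.
Proof.
rewrite -tofracB padic_norm_tofrac; split=> [/padic_int_norm_le abn|abn].
  by rewrite -{1}(subrK b a) residueD abn add0n residue_mod.
apply/padic_int_norm_le; rewrite -(residue0 p_pr n) -(subrr b).
by rewrite !residueD abn.
Qed.

Lemma padic_norm_nat k n : N k%:R <= (p%:R ^+ n)^-1 <-> (p ^ n %| k)%N.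
Proof.
have -> : (k%:R : Qp) = (k%:R : Zp)%:F - 0%:F.
  by rewrite tofrac0 subr0 rmorph_nat.
rewrite residue_eq_norm residue_nat residue0 /dvdn.
by split=> [->|/eqP].
Qed.

(** Write x = a / b and let p^v be the exact power of p dividing b; it
    divides a since |x| <= 1.  Truncating a and b modulo p^(v + n + 1) gives
    naturals A p^v and B p^v with B prime to p, and the wanted z solves
    z B = A modulo p^(n + 1). *)
Lemma nat_dense_unit_ball (x : Qp) n : N x <= 1 ->
  exists z : nat, N (x - z%:R) <= (p%:R ^+ n)^-1.
Proof.
have [a [b [b0 ->]]] := padic_fracP x.
have nb : padic_int_norm b = (p%:R ^+ padic_val b)^-1.
  by rewrite /padic_int_norm (negbTE b0).
have p0 k : 0 < p%:R ^+ k :> rat by rewrite exprn_gt0 ?natp_gt0.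
have [bv bSv] := padic_valP b0; set v := padic_val b in nb bv bSv.
rewrite padic_normE // nb ler_pdivrMr ?invr_gt0 // mul1r.
move=> /padic_int_norm_le av; pose M := (v + n.+1)%N.
have vM : (v <= M)%N by rewrite leq_addr.
have vM1 : (v.+1 <= M)%N by rewrite /M addnS ltnS leq_addr.
have /dvdnP[A EA] : (p ^ v %| a M)%N by rewrite -(residue_eq0 _ vM) av.
have /dvdnP[B EB] : (p ^ v %| b M)%N by rewrite -(residue_eq0 _ vM) bv.
have co : coprime B (p ^ n.+1).
  rewrite coprime_sym coprimeXl // prime_coprime //; apply/negP => pB.
  by apply: bSv; apply/eqP; rewrite (residue_eq0 _ vM1) EB expnS dvdn_mul.
have /dvdnP[z Ez] : (B %| chinese B (p ^ n.+1) 0 A)%N.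
  by rewrite /dvdn (chinese_modl co) mod0n.
exists z; have zb : (a - z%:R * b) M = 0%N.
  apply/padic_int_norm_le; rewrite -padic_norm_tofrac tofracB.
  apply/residue_eq_norm.
  rewrite residueM residue_nat modnMml EB mulnA -Ez -[LHS]residue_mod EA /M.
  rewrite expnD.
  by rewrite ![(_ * p ^ v)%N]mulnC -!muln_modr (chinese_modr co).
have -> : a%:F / b%:F - z%:R = (a - z%:R * b)%:F / b%:F.
  rewrite tofracB tofracM rmorph_nat mulrBl mulfK //.
  by rewrite tofrac_eq0.
rewrite padic_normE // nb ler_pdivrMr ?invr_gt0 // -invfM -exprD.
apply/padic_int_norm_le; apply: residue_eq0_le zb.
by rewrite /M addnC addnS.
Qed.

Lemma padic_discrete (x : Qp) : N x < 1 -> N x <= (p%:R ^+ 1)^-1.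
Proof.
move=> x1; have [z xz] := nat_dense_unit_ball 1 (ltW x1).
rewrite -(subrK z%:R x) (ultraD_le uN) //.
have z1 : N z%:R < 1.
  rewrite -[z%:R](subKr x) (ultraD_lt uN) // (ultraNeg uN).
  by rewrite (le_lt_trans xz) ?powV1_lt1 ?prime_gt1.
apply/padic_norm_nat; rewrite expn1; apply: contraLR z1 => pz; rewrite -leNgt.
have v0 : is_padic_val (z%:R : Zp) 0.
  by split; rewrite ?residue_at0 // residue_nat expn1; apply/eqP.
rewrite -(rmorph_nat (@FracField.tofrac Zp)) padic_norm_tofrac /padic_int_norm.
by rewrite (negbTE (is_padic_val_neq0 v0)) (padic_val_eq v0) invr1.
Qed.

(** Natural numbers approximating the terms of the sequence form a coherent
    family of residues, that is, a p-adic integer. *)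
Lemma padic_complete (w : nat -> Qp) : (forall n, N (w n) <= 1) ->
    (forall n, N (w n.+1 - w n) <= (p%:R ^+ n)^-1) ->
  exists l, forall n, N (w n - l) <= (p%:R ^+ n)^-1.
Proof.
move=> w1 w_cauchy.
have [z wz] := choice (fun n => nat_dense_unit_ball n (w1 n)).
have z_coherent n : (z n.+1 = z n %[mod p ^ n])%N.
  rewrite -!(residue_nat _ n); apply/residue_eq_norm; rewrite !rmorph_nat.
  rewrite -(subrKA (w n.+1)); apply: (ultraD_le uN).
    rewrite (ultraBC uN) (le_trans (wz n.+1)) // lef_pV2 ?posrE.
    - by rewrite ler_eXn2l // ltr1n prime_gt1.
    - by rewrite exprn_gt0 ?natp_gt0.
    by rewrite exprn_gt0 ?natp_gt0.
  by rewrite -(subrKA (w n)) (ultraD_le uN).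
exists (padic_int_of p_pr z_coherent)%:F => n.
rewrite -(subrKA (z n)%:R) (ultraD_le uN) //.
rewrite -(rmorph_nat (@FracField.tofrac Zp)); apply/residue_eq_norm.
by rewrite residue_nat.
Qed.

(** Modulo p, a root z would satisfy z^3 = 1; then Fermat's z^p = z becomes
    z^2 = z because p = 2 mod 3, so z = 1, and 3 = 0 modulo p. *)
Lemma prime_cyclotomic3 (z : nat) : (5 <= p)%N -> (p = 2 %[mod 3])%N ->
  ~~ (p %| z ^ 2 + z + 1)%N.
Proof.
move=> p5 p2; apply/negP => pz.
have z3 : (z ^ 3 = 1 %[mod p])%N.
  apply/eqP; case: z pz => [|z pz]; first by rewrite dvdn1 => /eqP E;
    rewrite E in p5.
  rewrite eqn_mod_dvd ?expn_gt0 //.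
  have -> : (z.+1 ^ 3 - 1 = z * (z.+1 ^ 2 + z.+1 + 1))%N.
    apply/eqP; rewrite -(eqn_add2r 1) subnK ?expn_gt0 //; apply/eqP.
    by rewrite !expnS expn0; ring.
  exact: dvdn_mull.
have pE : (p = (p %/ 3) * 3 + 2)%N by rewrite {1}(divn_eq p 3) p2.
have z3k k : ((z ^ 3) ^ k = 1 %[mod p])%N by rewrite -modnXm z3 modnXm exp1n.
(* z ^ p = (z ^ 3) ^ (p %/ 3) * z ^ 2 is congruent both to z and to z ^ 2. *)
have z2 : (z ^ 2 = z %[mod p])%N.
  have zp : (z ^ p = (z ^ 3) ^ (p %/ 3) * z ^ 2)%N.
    by rewrite -expnM [(3 * _)%N]mulnC -expnD -pE.
  by rewrite -(fermat_little z p_pr) zp -[RHS]modnMml z3k modnMml mul1n.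
have z1 : (z = 1 %[mod p])%N.
  by rewrite -z3 [(z ^ 3)%N]expnS -modnMmr z2 modnMmr mulnn z2.
move: pz; rewrite /dvdn -modnDml -(modnDm (z ^ 2)) z2 z1 modnDm modnDml.
rewrite modn_small //.
by rewrite (leq_trans _ p5).
Qed.

(** A reduction to [prime_cyclotomic3] by replacing g with a natural number
    congruent to it. *)
Lemma padic_norm_cyclotomic3 (g : Qp) : (5 <= p)%N -> (p = 2 %[mod 3])%N ->
  N g <= 1 -> N (g ^+ 2 + g + 1) = 1.
Proof.
move=> p5 p2 g1; have [z gz] := nat_dense_unit_ball 1 g1.
pose r := g - z%:R; have gE : g = z%:R + r by rewrite /r subrKC.
have r1 : N r < 1 by rewrite (le_lt_trans gz) ?powV1_lt1 ?prime_gt1.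
have nz : N (z ^ 2 + z + 1)%N%:R = 1.
  apply/le_anti; rewrite (ultra_nat uN) leNgt /=.
  apply: contra (prime_cyclotomic3 z p5 p2) => /padic_discrete.
  by move=> /padic_norm_nat; rewrite expn1.
have -> : g ^+ 2 + g + 1 = (z ^ 2 + z + 1)%N%:R + r * (g + z%:R + 1).
  by rewrite !natrD natrX gE; move: (z%:R : Qp) => t; ring.
rewrite (ultraD_dom uN) nz // (ultraM uN) (le_lt_trans _ r1) //.
rewrite ler_piMr ?(ultra_ge0 uN) //.
by do !apply: (ultraD_le uN); rewrite ?(ultra_nat uN) ?(ultra1 uN).
Qed.

End Padic.

(** * From the Potts--Bethe mapping to its recentred form *)

Lemma recentred_mapE (F : fieldType) (th t x : F) : x - 1 != 1 - th - t ->
  ((th * x + t - 1) / (x + th + t - 2%:R)) ^+ 3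
  = 1 + pb_step th (1 - th - t) (x - 1).
Proof.
rewrite -subr_eq0 => xc; rewrite /pb_step /pb_ratio subrKC; congr (_ ^+ 3).
have xE : x + th + t - 2%:R = x - 1 - (1 - th - t) by ring.
by rewrite xE; field.
Qed.

Lemma recentred_singular (F : fieldType) (th t x : F) :
  (x == 2%:R - th - t) = (x - 1 == 1 - th - t).
Proof. by rewrite -subr_eq0 -[RHS]subr_eq0; congr (_ == 0); ring. Qed.

Lemma recentred_x1 (F : fieldType) (th t y : F) :
  1 - t + (th - 1) * (y - 1) - 1 = 1 - th - t + (th - 1) * y.
Proof. by ring. Qed.

Section PottsBetheBasin.
Context (p : nat) (p_pr : prime p) (theta : padic p_pr) (q : nat).
Local Notation c := (1 - theta - q%:R).

Lemma potts_bethe_recentred (x : padic p_pr) : potts_bethe theta q x =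
  if x - 1 == c then None else Some (1 + pb_step theta c (x - 1)).
Proof.
rewrite /potts_bethe /x_infty recentred_singular.
by case: eqVneq => // xc; rewrite recentred_mapE.
Qed.

Lemma potts_bethe_iterS n (x : padic p_pr) : potts_bethe_iter theta q n.+1 x =
  obind (potts_bethe theta q) (potts_bethe_iter theta q n x).
Proof. by []. Qed.

Lemma potts_bethe_iter_fixed (x : padic p_pr) :
  potts_bethe theta q x = Some x ->
  forall n, potts_bethe_iter theta q n x = Some x.
Proof. by move=> fx; elim=> [//|n IHn]; rewrite potts_bethe_iterS IHn. Qed.

Lemma basin_regular (x l : padic p_pr) n : basin theta q l x ->
  ~ potts_bethe_preimage theta q n [set x_infty theta q] x.
Proof.
move=> [u itu _] [y ity /= yE]; have := itu n.+1.
rewrite potts_bethe_iterS ity /=.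
by rewrite yE /potts_bethe eqxx.
Qed.

Lemma regular_orbit (x : padic p_pr) :
    (forall n, ~ potts_bethe_preimage theta q n [set x_infty theta q] x) ->
  exists2 w : nat -> padic p_pr,
    forall n, potts_bethe_iter theta q n x = Some (1 + w n) &
    forall n, w n != c /\ w n.+1 = pb_step theta c (w n).
Proof.
move=> reg; pose u n := odflt 0 (potts_bethe_iter theta q n x).
have regular n y : potts_bethe_iter theta q n x = Some y -> y - 1 != c.
  move=> ity; apply/negP; rewrite -recentred_singular => /eqP yE.
  by apply: (reg n); exists y.
have itu n : potts_bethe_iter theta q n x = Some (u n).
  elim: n => [//|n IHn]; rewrite /u potts_bethe_iterS IHn /=.
  by rewrite potts_bethe_recentred (negbTE (regular _ _ IHn)).
exists (fun n => u n - 1) => n; first by rewrite subrKC.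
split; first exact: regular (itu n).
have := itu n.+1; rewrite potts_bethe_iterS itu /= potts_bethe_recentred.
by rewrite (negbTE (regular _ _ (itu n))) => -[<-]; rewrite addrC addKr.
Qed.

End PottsBetheBasin.

Theorem theorem4p7 (p : nat) (p_pr : prime p) (p_ge5 : (5 <= p)%N)
    (p_mod3 : (p = 2 %[mod 3])%N) (q : nat) (theta : padic p_pr)
    (theta_q : padic_norm (theta - 1) < padic_norm (q%:R : padic p_pr))
    (q_lt1 : padic_norm (q%:R : padic p_pr) < 1)
    (nondeg : (theta - 1) * (1 - theta - q%:R) != 0) :
  basin theta q 1 =
  ~` ([set x_1 theta q] `|`
      \bigcup_n potts_bethe_preimage theta q n [set x_infty theta q]).
Proof.
pose uN := padic_ultrametric p_pr; have p1 := prime_gt1 p_pr.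
have disc := @padic_discrete p p_pr; have compl := @padic_complete p p_pr.
have cyc g := @padic_norm_cyclotomic3 p p_pr g p_ge5 p_mod3.
set c := 1 - theta - q%:R in nondeg *.
have d0 : theta - 1 != 0 by move: nondeg; rewrite mulf_eq0 => /norP[].
(* |theta - 1| < |q| makes q the dominant term of c. *)
have cE : c = - q%:R - (theta - 1) by rewrite opprB addrC.
have cN : padic_norm c = padic_norm (q%:R : padic p_pr).
  by rewrite cE (ultraD_dom uN) !(ultraNeg uN).
have dc : padic_norm (theta - 1) < padic_norm c by rewrite cN.
have c1 : padic_norm c < 1 by rewrite cN.
have [root_y _] : unique (fun y => potts_cubic theta q y = 0) (y_1 theta q).
  have [y root_y] := cubic_root_ex uN p1 disc compl cyc dc c1.
  rewrite /y_1; apply: xgetPex; exists y; split=> // z root_z.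
  exact: (cubic_root_unique uN p1 disc cyc d0 dc c1).
pose v := c + (theta - 1) * y_1 theta q.
have x1E : x_1 theta q - 1 = v by exact: recentred_x1.
have v_fix : pb_step theta c v = v by apply: (cubic_root_fixed uN d0 dc root_y).
have v_sphere : padic_norm (v - c) = padic_norm (theta - 1).
  exact: (cubic_root_sphere uN p1 disc cyc d0 dc c1 root_y).
apply/seteqP; split=> x /=.
  move=> bx [x1|[n _]]; last exact: basin_regular bx.
  have [u itu ucvg] := bx.
  have fx : potts_bethe theta q x = Some x.
    rewrite potts_bethe_recentred x1 x1E v_fix -x1E subrKC x1E ifN //.
    by rewrite -subr_eq0 -(ultra_gt0 uN) v_sphere (ultra_gt0 uN).
  have vN : padic_norm v = padic_norm c by apply: (sphere_norm uN dc).
  have v_gt0 : 0 < padic_norm v by rewrite vN (c_gt0 uN dc).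
  have [M /(_ M (leqnn M))] := ucvg _ v_gt0.
  have := itu M; rewrite (potts_bethe_iter_fixed fx) => -[<-].
  by rewrite x1 x1E ltxx.
(* Conversely, a regular orbit that is not attracted lies on the sphere where
   the orbit of x^(1) - 1 is the only one. *)
move=> nx; have [|w itw wP] := @regular_orbit p p_pr theta q x.
  by move=> n pre; apply: nx; right; exists n.
have w_reg n : w n != c by have [] := wP n.
have w_step n : w n.+1 = pb_step theta c (w n) by have [] := wP n.
have [[m wm]|w_sphere] := orbit_enters_or_stays uN cyc dc c1 w_reg w_step.
  exists (fun n => 1 + w n) => // e e0.
  have [M MP] := orbit_inside_cvg uN p1 disc cyc dc c1 w_step wm e0.
  by exists M => n /MP; rewrite addrC addKr.
case: nx; left; have [] := itw 0%N; rewrite /potts_bethe_iter /= => ->.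
have -> :=
  sphere_orbit_unique uN p1 disc cyc d0 dc c1 w_step w_sphere v_fix v_sphere.
by rewrite -x1E subrKC.
Qed.
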